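(* Let $\tilde W$ be a Coxeter group with finite set of simple reflections $\tilde S$ and length function $\tilde l:\tilde W\to\mathbf N$, and let $\tau:\tilde W\to\tilde W$ be a group automorphism with $\tau(\tilde S)=\tilde S$. Let $S$ be the set of $\tau$-orbits $I$ on $\tilde S$ such that the subgroup $\tilde W_I$ generated by $I$ is finite, and for $I\in S$ let $w_0^I$ be the longest element of $\tilde W_I$. Let $W=\{w\in\tilde W:\tau(w)=w\}$, viewed as a Coxeter group with set of simple reflections $\{w_0^I:I\in S\}$. Let $L:W\to\mathbf N$ be the restriction of $\tilde l$ to $W$. Then $L$ is a weight function for $W,S$.
   Context: It is known that $W$ is a Coxeter group with simple reflections $w_0^I$ ($I\in S$). Let $l:W\to\mathbf N$ be the length function of $W$ with respect to these simple reflections. A weight function on $W$ is a map $L:W\to\mathbf Z$ such that $L(ww')=L(w)+L(w')$ for all $w,w'\in W$ with $l(ww')=l(w)+l(w')$. *)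

(* Defs.v *)
From HB Require Import structures.
From mathcomp Require Import all_boot all_order all_algebra.
From mathcomp Require Import boolp classical_sets functions cardinality.

Set Implicit Arguments.
Unset Strict Implicit.
Unset Printing Implicit Defensive.

Local Open Scope classical_set_scope.
Local Open Scope group_scope.

(* Groups are MathComp's [groupType]s, which may be infinite; the set of simple
   reflections is a subset of the carrier. *)

Definition word_over (G : groupType) (S : set G) (u : seq G) : Prop :=
  forall s, s \in u -> S s.

Definition word_prod (G : groupType) (u : seq G) : G := \prod_(s <- u) s.

(* The exponent 0 encodes m(s,t) = oo (no relation between s and t). *)
Definition coxeter_matrix (G : groupType) (S : set G) (m : G -> G -> nat) : Prop :=
  forall s t, S s -> S t ->
    [/\ m s s = 1%N, m s t = m t s & s <> t -> m s t <> 1%N].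

(* The congruence on words generated by (s t)^m(s,t) = 1 for s, t in S; for
   m(s,t) = 0 the rule is void.  As m(s,s) = 1 gives s s = 1, formal inverses of
   letters are not needed. *)
Inductive coxeter_cong (G : groupType) (S : set G) (m : G -> G -> nat) :
    seq G -> seq G -> Prop :=
| coxeter_cong_rel u v s t : S s -> S t ->
    coxeter_cong S m (u ++ flatten (nseq (m s t) [:: s; t]) ++ v) (u ++ v)
| coxeter_cong_refl u : coxeter_cong S m u u
| coxeter_cong_sym u v : coxeter_cong S m u v -> coxeter_cong S m v u
| coxeter_cong_trans u v w :
    coxeter_cong S m u v -> coxeter_cong S m v w -> coxeter_cong S m u w.

(* G is the group presented by the generators S and the Coxeter relations of
   some Coxeter matrix. *)
Definition coxeter_group (G : groupType) (S : set G) : Prop :=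
  exists m : G -> G -> nat,
    [/\ coxeter_matrix S m,
        forall w : G, exists2 u, word_over S u & word_prod u = w
      & forall u v, word_over S u -> word_over S v ->
          word_prod u = word_prod v <-> coxeter_cong S m u v].

Definition has_word_of_size (G : groupType) (S : set G) (w : G) (n : nat) : Prop :=
  exists u, [/\ word_over S u, size u = n & word_prod u = w].

(* The least size of a word over S with product w (0 if there is none, which
   does not happen when S consists of involutions and generates G). *)
Definition cox_length (G : groupType) (S : set G) (w : G) : nat :=
  match pselect (exists n, `[< has_word_of_size S w n >]) with
  | left h => ex_minn h
  | right _ => 0%N
  end.

Definition weight_function (G : groupType) (S : set G) (L : G -> int) : Prop :=
  forall w w' : G,
    cox_length S (w * w') = (cox_length S w + cox_length S w')%N ->
    L (w * w') = (L w + L w')%R.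

Definition is_subgroup (G : groupType) (H : set G) : Prop :=
  H 1 /\ forall x y, H x -> H y -> H (x * y^-1).

Definition generated_subgroup (G : groupType) (I : set G) : set G :=
  smallest (@is_subgroup G) I.

(* The orbit under the cyclic group generated by the permutation tau. *)
Definition orbit_of (T : Type) (tau : T -> T) (s : T) : set T :=
  [set t | exists n, t = iter n tau s \/ s = iter n tau t].

(* w is the longest element of the subgroup generated by I. *)
Definition longest_in (G : groupType) (S I : set G) (w : G) : Prop :=
  generated_subgroup I w /\
  forall x, generated_subgroup I x -> (cox_length S x <= cox_length S w)%N.

Section FixedSubgroup.
Variables (G : groupType) (tau : {multiplicative G -> G}).

Definition fixed_pred : pred G := fun w => tau w == w.

Record fixed_group := FixedGroup {
  fixed_val :> G;
  fixed_valP : fixed_pred fixed_val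
}.

Lemma fixed_group_closed : group_closed fixed_pred.
Proof.
have t1 : tau 1 = 1.
  by apply: (mulgI (tau 1)); rewrite -gmulfM !mulg1.
split=> [|x y]; rewrite !unfold_in ?t1 // => /eqP xE /eqP yE.
rewrite gmulfM xE; apply/eqP; congr (_ * _).
by apply: (mulgI y); rewrite -{1}yE -gmulfM !mulgV.
Qed.

HB.instance Definition _ := [isSub for fixed_val].
HB.instance Definition _ := [Choice of fixed_group by <:].
HB.instance Definition _ :=
  SubChoice_isSubGroup.Build G fixed_pred fixed_group fixed_group_closed.

End FixedSubgroup.

Definition finite_orbits (G : groupType) (S : set G) (tau : G -> G) :
    set (set G) :=
  [set I | (exists2 s, S s & I = orbit_of tau s) /\
           finite_set (generated_subgroup I)].

(* The set { w_0^I }, as a subset of the group of tau-fixed elements. *)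
Definition fixed_reflections (G : groupType) (S : set G)
    (tau : {multiplicative G -> G}) : set (fixed_group tau) :=
  [set w | exists2 I, finite_orbits S tau I & longest_in S I (val w)].

(* Main.v *)
(** Exchange condition: to a word associate the list of reflections [t] such that
    right multiplication by [t] deletes one letter. The parity of the number of
    occurrences of each reflection is invariant under the Coxeter relations, and
    a descent [s] of the product of the word occurs an odd number of times.

    Weight function: write [w_I] for the longest element attached to an orbit
    [I]. A tau-fixed [w] has either all or none of [I] among its right descents;
    in the first case the length drops by that of [w_I] in [w * w_I], in the
    second it grows by that amount. So it suffices that no descent occurs along
    a reduced word in the [w_I], and this is an exchange condition for the fixed
    group: if [I] becomes a set of descents when [y] is multiplied on the left
    by [w_J], then [w_J * y = y * w_I]. *)

Require Import Defs.
From mathcomp Require Import all_boot all_order all_algebra zify.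
From mathcomp Require Import boolp classical_sets functions cardinality.

Set Implicit Arguments.
Unset Strict Implicit.
Unset Printing Implicit Defensive.

Local Open Scope classical_set_scope.

(** * Words, their products, and length over a generating set *)

Section Words.
Variable G : groupType.
Implicit Types (S I : set G) (u v : seq G) (s w x : G).

Local Open Scope group_scope.

Lemma word_prod_nil : word_prod (G := G) [::] = 1.
Proof. exact: big_nil. Qed.

Lemma word_prod_cons s u : word_prod (s :: u) = s * word_prod u.
Proof. exact: big_cons. Qed.

Lemma word_prod_cat u v : word_prod (u ++ v) = word_prod u * word_prod v.
Proof. exact: big_cat. Qed.

Lemma word_prod_rcons u s : word_prod (rcons u s) = word_prod u * s.
Proof. by rewrite -cats1 word_prod_cat word_prod_cons word_prod_nil mulg1. Qed.

Lemma word_over_nil S : word_over S [::].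
Proof. by []. Qed.

Lemma word_over_cons S s u : word_over S (s :: u) <-> S s /\ word_over S u.
Proof.
split=> [us|[Ss us] t].
  by split=> [|t tu]; apply: us; rewrite in_cons ?eqxx ?tu ?orbT.
by rewrite in_cons => /orP[/eqP->|/us].
Qed.

Lemma word_over_cat S u v :
  word_over S (u ++ v) <-> word_over S u /\ word_over S v.
Proof.
elim: u => [|s u IHu] /=; first by split=> [|[]].
rewrite !word_over_cons IHu; tauto.
Qed.

Lemma word_over_rcons S u s : word_over S (rcons u s) <-> word_over S u /\ S s.
Proof. by rewrite -cats1 word_over_cat word_over_cons; split=> [[? []]|[]]. Qed.

Lemma word_over_sub S I u : I `<=` S -> word_over I u -> word_over S u.
Proof. by move=> IS uI s /uI /IS. Qed.

Lemma cox_length_le_size S u :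
  word_over S u -> (cox_length S (word_prod u) <= size u)%N.
Proof.
move=> uS; rewrite /cox_length; case: pselect => // h.
by case: ex_minnP => n _; apply; apply/asboolP; exists u.
Qed.

Lemma reduced_word S u : word_over S u ->
  exists v, [/\ word_over S v, size v = cox_length S (word_prod u)
              & word_prod v = word_prod u].
Proof.
move=> uS; rewrite /cox_length; case: pselect => [h|[]].
  by case: ex_minnP => n /asboolP[v [? ? ?]] _; exists v.
by exists (size u); apply/asboolP; exists u.
Qed.

Lemma word_prod_rev u :
  (forall s, s \in u -> s * s = 1) -> word_prod (rev u) = (word_prod u)^-1.
Proof.
elim: u => [_|s u IHu us]; first by rewrite word_prod_nil invg1.
rewrite rev_cons word_prod_rcons IHu => [|t tu]; last first.
  by apply: us; rewrite in_cons tu orbT.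
rewrite word_prod_cons invgM; congr (_ * _).
by apply: (mulgI s); rewrite mulgV us // in_cons eqxx.
Qed.

(** Reversing a word in involutions inverts its product, so the products of words over [I] already
    form a subgroup. *)
Lemma generated_subgroupP I w : (forall s, I s -> s * s = 1) ->
  generated_subgroup I w <-> exists2 u, word_over I u & word_prod u = w.
Proof.
move=> I2; split=> [|[u uI <-]].
  apply: (smallest_sub (X := [set w | exists2 u, word_over I u & word_prod u = w])).
    split; first by exists [::] => //; exact: word_prod_nil.
    move=> _ _ [u uI <-] [v vI <-]; exists (u ++ rev v).
      by rewrite word_over_cat; split=> // s; rewrite mem_rev => /vI.
    by rewrite word_prod_cat word_prod_rev // => s /vI /I2.
  move=> s Is; exists [:: s]; first by apply/word_over_cons.
  by rewrite word_prod_cons word_prod_nil mulg1.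
move=> H [[H1 HF] IH].
have HM x y : H x -> H y -> H (x * y).
  move=> Hx Hy; rewrite -[y]invgK; apply: (HF) => //.
  by rewrite -[_^-1]mul1g; apply: HF.
elim: u uI => [|s u IHu]; first by rewrite word_prod_nil.
by rewrite word_over_cons word_prod_cons => -[/IH Hs /IHu]; apply: HM.
Qed.

End Words.

(** * The exchange condition *)

Section Coxeter.
Variables (G : groupType) (S : set G).
Hypothesis S_coxeter : coxeter_group S.
Implicit Types (I : set G) (u v : seq G) (s t w x y : G).

Local Notation l := (cox_length S).

Local Open Scope group_scope.

Lemma simple_mulgg s : S s -> s * s = 1.
Proof.
case: S_coxeter => m [mP _ congP] Ss.
have [ms _ _] := mP s s Ss Ss.
have /congP : word_over S [:: s; s] by rewrite !word_over_cons.
move=> /(_ [::] (word_over_nil S))[_].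
rewrite !word_prod_cons word_prod_nil mulg1; apply.
by have := @coxeter_cong_rel _ S m [::] [::] s s Ss Ss; rewrite ms.
Qed.

Lemma simple_invg s : S s -> s^-1 = s.
Proof. by move=> /simple_mulgg s2; apply: (mulgI s); rewrite mulgV. Qed.

Lemma word_exists w : exists2 u, word_over S u & word_prod u = w.
Proof. by case: S_coxeter => m []. Qed.

Lemma reduced_word_exists w :
  exists u, [/\ word_over S u, size u = l w & word_prod u = w].
Proof. by have [u uS <-] := word_exists w; apply: reduced_word. Qed.

(** Each relator has even size [2 * m s t]; this parity is the sign character of the Coxeter
    group. *)
Lemma cong_odd_size m u v :
  coxeter_cong S m u v -> odd (size u) = odd (size v).
Proof.
elim=> {u v} [u v s t _ _|||u v w _ -> _ ->] //.
rewrite !size_cat size_flatten /shape map_nseq sumn_nseq /= mul2n.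
by rewrite !oddD odd_double.
Qed.

Lemma odd_cox_length u : word_over S u -> odd (l (word_prod u)) = odd (size u).
Proof.
move=> uS; have [v [vS <- vu]] := reduced_word_exists (word_prod u).
by case: S_coxeter => m [_ _ /(_ _ _ vS uS)[/(_ vu) /cong_odd_size ->]].
Qed.

Lemma cox_length1 : l 1 = 0%N.
Proof.
apply/eqP; rewrite -leqn0 -(word_prod_nil G).
exact: (cox_length_le_size (word_over_nil S)).
Qed.

Lemma cox_length_eq0 w : l w = 0%N -> w = 1.
Proof.
by have [u [_ <- <-]] := reduced_word_exists w; case: u => // _;
   apply: word_prod_nil.
Qed.

Lemma cox_lengthM w x : (l (w * x) <= l w + l x)%N.
Proof.
have [u [uS <- {1}<-]] := reduced_word_exists w.
have [v [vS <- {1}<-]] := reduced_word_exists x.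
rewrite -word_prod_cat -size_cat; apply: cox_length_le_size.
by rewrite word_over_cat.
Qed.

Lemma cox_lengthV w : l w^-1 = l w.
Proof.
suff le_V x : (l x^-1 <= l x)%N.
  by apply/eqP; rewrite eqn_leq le_V -{1}[w]invgK le_V.
have [u [uS <- {1}<-]] := reduced_word_exists x.
rewrite -word_prod_rev => [|s /uS /simple_mulgg //].
by rewrite -size_rev; apply: cox_length_le_size => s; rewrite mem_rev => /uS.
Qed.

Lemma cox_length_simple s : S s -> l s = 1%N.
Proof.
move=> Ss; have sS : word_over S [:: s] by rewrite word_over_cons.
have := odd_cox_length sS; have := cox_length_le_size sS.
rewrite word_prod_cons word_prod_nil mulg1 /=.
by case: (l s) => [|[]].
Qed.

(** Subadditivity bounds the change of length by one, and the parity of word sizes rules out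
    equality. *)
Lemma cox_lengthMs w s : S s -> l (w * s) = (l w).+1 \/ l w = (l (w * s)).+1.
Proof.
move=> Ss; have [u [uS _ uw]] := reduced_word_exists w.
have usS : word_over S (rcons u s) by rewrite word_over_rcons.
have := odd_cox_length usS; rewrite word_prod_rcons uw size_rcons /=.
rewrite -(odd_cox_length uS) uw.
have := cox_lengthM w s; have := cox_lengthM (w * s) s.
rewrite -mulgA simple_mulgg // mulg1 (cox_length_simple Ss).
set a := l w; set b := l _ => ab ba par.
have : a != b by apply: contraPneq par => ->; case: odd.
by lia.
Qed.

(* The reflections [t] such that [word_prod u * t] is [u] with one letter
   deleted. *)
Fixpoint reflections_of u : seq G :=
  if u is s :: v then s ^ word_prod v :: reflections_of v else [::].

Lemma reflections_of_cat u v :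
  reflections_of (u ++ v) =
  [seq t ^ word_prod v | t <- reflections_of u] ++ reflections_of v.
Proof. by elim: u => //= s u ->; rewrite word_prod_cat conjgM. Qed.

Lemma reflections_of_delete u t : word_over S u -> t \in reflections_of u ->
  exists v, [/\ {subset v <= u}, size u = (size v).+1
              & word_prod u * t = word_prod v].
Proof.
elim: u => //= s u IHu; rewrite word_over_cons in_cons => -[Ss uS].
case/orP => [/eqP->|/(IHu uS)[v [vu -> put]]].
  exists u; split=> // [r ru|]; first by rewrite in_cons ru orbT.
  by rewrite word_prod_cons -mulgA -conjgC mulgA simple_mulgg ?mul1g.
exists (s :: v); split=> // [r|]; last by rewrite !word_prod_cons -mulgA put.
by rewrite !in_cons => /orP[->//|/vu ->]; rewrite orbT.
Qed.

(** The involution [t] inverts the rotation [s * t], so moving [t] to the front of the conjugate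
    turns [(s * t) ^- k] into [(s * t) ^+ k]. *)
Lemma simple_conjX s t k : S s -> S t -> t ^ ((s * t) ^+ k) = t * (s * t) ^+ k.*2.
Proof.
move=> Ss St; rewrite -addnn expgnDr /conjg !mulgA; congr (_ * _).
have stV : (s * t)^-1 * t = t * (s * t) by rewrite invgM !simple_invg // mulgA.
elim: k => [|k IHk]; first by rewrite expg0 invg1 mul1g mulg1.
by rewrite expgS invgM -mulgA stV mulgA IHk -mulgA -expgSr -expgS.
Qed.

Lemma word_prod_alternating s t k :
  word_prod (flatten (nseq k [:: s; t])) = (s * t) ^+ k.
Proof.
elim: k => [|k IHk] /=; first by rewrite word_prod_nil expg0.
by rewrite !word_prod_cons IHk expgS mulgA.
Qed.

(** Writing the reflections as [t] times consecutive powers of [s * t] makes their periodicity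
    visible once [s * t] has finite order. *)
Lemma reflections_of_alternating s t k : S s -> S t ->
  reflections_of (flatten (nseq k [:: s; t])) =
  rev (mkseq (fun j => t * (s * t) ^+ j) k.*2).
Proof.
move=> Ss St; elim: k => [//|k IHk].
rewrite [LHS]/= IHk word_prod_cons word_prod_alternating doubleS !mkseqS !rev_rcons.
congr [:: _, _ & _]; last exact: simple_conjX.
have -> : s ^ (t * (s * t) ^+ k) = (t * (s * t)) ^ ((s * t) ^+ k).
  by rewrite conjgM; congr (_ ^ _); rewrite /conjg simple_invg.
rewrite conjMg simple_conjX // [in RHS]expgSr [RHS]mulgA; congr (_ * _).
by rewrite /conjg -expgS expgSr mulKg.
Qed.

Lemma coxeter_relation m s t : (forall u v, word_over S u -> word_over S v ->
    word_prod u = word_prod v <-> coxeter_cong S m u v) ->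
  S s -> S t -> (s * t) ^+ m s t = 1.
Proof.
move=> congP Ss St; rewrite -word_prod_alternating -(word_prod_nil G).
have rS : word_over S (flatten (nseq (m s t) [:: s; t])).
  elim: (m s t) => [|k IHk] /=; first exact: word_over_nil.
  by rewrite !word_over_cons.
apply/(congP _ _ rS (word_over_nil S)).
by have := coxeter_cong_rel m [::] [::] Ss St; rewrite cats0.
Qed.

(* As [(s t)^m = 1], the [2m] reflections of the relator [(s t)^m] list [m] of
   them twice. *)
Lemma odd_count_reflections m u v : (forall u v, word_over S u -> word_over S v ->
    word_prod u = word_prod v <-> coxeter_cong S m u v) ->
  coxeter_cong S m u v ->
  word_prod u = word_prod v /\
  forall P : pred G,
    odd (count P (reflections_of u)) = odd (count P (reflections_of v)).
Proof.
move=> congP; elim=> {u v} [u v s t Ss St|//|u v _ [-> IH]|].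
- have st1 := coxeter_relation congP Ss St.
  rewrite !word_prod_cat word_prod_alternating st1 mul1g; split=> // P.
  rewrite !reflections_of_cat word_prod_cat word_prod_alternating st1 mul1g.
  rewrite !count_cat !oddD; congr (_ (+) _).
  rewrite reflections_of_alternating // count_map count_rev -addnn.
  rewrite /mkseq iotaD map_cat count_cat add0n.
  set f : nat -> G := fun j => t * _ ^+ j.
  rewrite [X in (_ + count _ X)%N](_ : _ = mkseq f (m s t)).
    by rewrite addnn odd_double.
  by rewrite /mkseq -{1}[m s t]addn0 iotaDl -map_comp; apply: eq_map => j;
     rewrite /f /= expgnDr st1 mul1g.
- by split=> // P; rewrite IH.
- by move=> u v w _ [-> IHu] _ [-> IHv]; split=> // P; rewrite IHu.
Qed.

(** Compare [u] with [rcons v s], where [v] is a reduced word for [word_prod u * s]. Both have the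
    same product, so [s] occurs with the same parity in their reflection lists; in the second list
    it occurs exactly once, as the last entry. *)
Lemma descent_reflection u s : word_over S u -> S s ->
  (l (word_prod u * s) < l (word_prod u))%N -> s \in reflections_of u.
Proof.
move=> uS Ss ltus.
have [v [vS vl vu]] := reduced_word_exists (word_prod u * s).
have vsS : word_over S (rcons v s) by rewrite word_over_rcons.
have vsu : word_prod (rcons v s) = word_prod u.
  by rewrite word_prod_rcons vu -mulgA simple_mulgg // mulg1.
case: S_coxeter => m [_ _ congP].
have [_ /(_ (pred1 s))] := odd_count_reflections congP ((congP _ _ vsS uS).1 vsu).
rewrite -cats1 reflections_of_cat count_cat /= !word_prod_cons word_prod_nil mulg1.
rewrite conjg1 eqxx addn0 addn1 /= count_map.
(* Conjugation by [s] is injective and fixes [s], so it does not change the number of occurrences of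
   [s]. *)
rewrite (eq_count (a2 := pred1 s)) => [|x /=]; last first.
  by rewrite -{2}[s]mul1g -(mulVg s) -mulgA -/(conjg s s) (inj_eq (@conjg_inj _ s)).
have [sv _|/count_memPn -> /= /esym] := boolP (s \in reflections_of v); last first.
  by move=> odd_u; rewrite -has_pred1 has_count; case: count odd_u.
(* If [s] came from [v], deleting a letter of [v] would give a word for [word_prod u] shorter than
   its length. *)
have [v' [v'v vv' vsE]] := reflections_of_delete vS sv.
have := cox_length_le_size (fun r rv' => vS r (v'v r rv')).
rewrite -vsE vu -mulgA simple_mulgg // mulg1.
by move: ltus; rewrite -vl vv'; lia.
Qed.

Lemma exchange_cat u v s : word_over S u -> word_over S v -> S s ->
  (l (word_prod u * word_prod v * s) < l (word_prod u * word_prod v))%N ->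
  (exists u', [/\ {subset u' <= u}, size u = (size u').+1
                & word_prod u * word_prod v * s = word_prod u' * word_prod v]) \/
  (exists v', [/\ {subset v' <= v}, size v = (size v').+1
                & word_prod v * s = word_prod v']).
Proof.
move=> uS vS Ss; rewrite -word_prod_cat => /descent_reflection.
rewrite word_over_cat => /(_ (conj uS vS) Ss).
rewrite reflections_of_cat mem_cat word_prod_cat.
case/orP => [/mapP[t tu ->]|/(reflections_of_delete vS)]; last by right.
have [u' [u'u usz ut]] := reflections_of_delete uS tu.
by left; exists u'; split=> //; rewrite -mulgA -conjgC mulgA ut.
Qed.

Lemma exchange u s : word_over S u -> S s ->
  (l (word_prod u * s) < l (word_prod u))%N ->
  exists v, [/\ {subset v <= u}, size u = (size v).+1
              & word_prod u * s = word_prod v].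
Proof.
by move=> uS Ss /(descent_reflection uS Ss); apply: reflections_of_delete.
Qed.

(** * Parabolic subgroups *)

Section Parabolic.
Variable I : set G.
Hypothesis IS : I `<=` S.

Local Notation W_I := (generated_subgroup I).

Definition all_descents w := forall s, I s -> (l (w * s) < l w)%N.

Definition no_descent w := forall s, I s -> (l w < l (w * s))%N.

Lemma parabolicP x : W_I x <-> exists2 u, word_over I u & word_prod u = x.
Proof. by apply: generated_subgroupP => s /IS /simple_mulgg. Qed.

Lemma parabolicM x y : W_I x -> W_I y -> W_I (x * y).
Proof.
move=> /parabolicP[u uI <-] /parabolicP[v vI <-]; apply/parabolicP.
by exists (u ++ v); rewrite ?word_prod_cat ?word_over_cat.
Qed.

Lemma parabolic1 : W_I 1.
Proof. by move=> H [[]]. Qed.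

Lemma parabolic_gen s : I s -> W_I s.
Proof. by move=> Is H [_]; apply. Qed.

Lemma parabolicV x : W_I x -> W_I x^-1.
Proof.
move=> Wx H HI; rewrite -[_^-1]mul1g.
by case: (HI.1) => H1; apply=> //; apply: Wx.
Qed.

(** Exchange only deletes letters, so shortening a word over [I] never leaves [I]: length over [S]
    is attained inside [I]. *)
Lemma parabolic_reduced_word x : W_I x ->
  exists u, [/\ word_over I u, size u = l x & word_prod u = x].
Proof.
move=> /parabolicP[u + <-]; elim/last_ind: u => [_|u s IHu].
  by exists [::]; rewrite word_prod_nil cox_length1.
rewrite word_over_rcons word_prod_rcons => -[/IHu[v [vI vl vu]] Is].
rewrite -vu in vl *.
have [up|down] := cox_lengthMs (word_prod v) (IS Is).
  exists (rcons v s); split; first by rewrite word_over_rcons.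
    by rewrite size_rcons vl up.
  by rewrite word_prod_rcons.
have [|v' [v'v vsz vsE]] := exchange (word_over_sub IS vI) (IS Is).
  by rewrite down.
exists v'; split=> [r /v'v /vI//| |//].
by apply: succn_inj; rewrite -vsz vl down.
Qed.

(* A reduced word for [x] is peeled off [w] from its far end: if [w = c * x'] is
   reduced and [x = x' * s], exchanging [s] cannot shorten [x'], so it shortens
   [c]. *)
Lemma all_descents_cox_length w x :
  all_descents w -> W_I x -> (l (w * x^-1) + l x = l w)%N.
Proof.
move=> wI /parabolic_reduced_word[u [uI + xE]]; rewrite -{x}xE.
elim/last_ind: u uI => [|u s IHu].
  by rewrite word_prod_nil invg1 mulg1 cox_length1 addn0.
rewrite word_over_rcons word_prod_rcons size_rcons => -[uI Is] usz.
have uS := word_over_sub IS uI; have Ss := IS Is.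
have ul : size u = l (word_prod u).
  have := cox_length_le_size uS; have := cox_lengthM (word_prod u) s.
  by rewrite -usz (cox_length_simple Ss); lia.
have {}IHu := IHu uI ul.
have [c [cS csz cw]] := reduced_word_exists (w * (word_prod u)^-1).
have wE : word_prod c * word_prod u = w by rewrite cw mulgVK.
have [|[c' [c'c c'sz ws]]|[u' [u'u u'sz us]]] := exchange_cat cS uS Ss.
- by rewrite wE; apply: wI.
- have wsE : w * (word_prod u * s)^-1 = word_prod c'.
    by rewrite invgM simple_invg // mulgA -wE ws mulgK.
  have := cox_length_le_size (fun r rc' => cS r (c'c r rc')).
  have := cox_lengthM (w * (word_prod u * s)^-1) (word_prod u * s).
  by rewrite mulgVK wsE -usz; lia.
- have := cox_length_le_size (fun r ru' => uS r (u'u r ru')).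
  by rewrite -us -usz; lia.
Qed.

Lemma all_descents_le w x : all_descents w -> W_I x -> (l x <= l w)%N.
Proof. by move=> wI /(all_descents_cox_length wI) <-; apply: leq_addl. Qed.

(** * Longest elements of parabolic subgroups *)

Lemma longest_all_descents w : longest_in S I w -> all_descents w.
Proof.
move=> [Ww wmax] s Is; have := wmax _ (parabolicM Ww (parabolic_gen Is)).
by have := cox_lengthMs w (IS Is); lia.
Qed.

Lemma longest_unique w x : longest_in S I w -> longest_in S I x -> w = x.
Proof.
move=> wmax [Wx xmax].
have := all_descents_cox_length (longest_all_descents wmax) Wx.
have := xmax _ wmax.1 => xw lw; have /cox_length_eq0 wx : l (w * x^-1) = 0%N by lia.
exact: divg1_eq.
Qed.

Lemma longest_mulgg w : longest_in S I w -> w * w = 1.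
Proof.
move=> wmax; have wI := longest_all_descents wmax; have [Ww _] := wmax.
have := all_descents_cox_length wI (parabolicV Ww).
by rewrite invgK cox_lengthV => ww; apply: cox_length_eq0; lia.
Qed.

Lemma longest_all_descentsP w :
  longest_in S I w <-> W_I w /\ all_descents w.
Proof.
split=> [wmax|[Ww wI]]; first by split; [exact: wmax.1|exact: longest_all_descents].
by split=> // x; apply: all_descents_le.
Qed.

(** The last letter of a nonempty reduced word over [I] would be a descent. *)
Lemma parabolic_no_descent x : W_I x -> no_descent x -> x = 1.
Proof.
move=> /parabolic_reduced_word[u [uI + xE]]; rewrite -{x}xE.
case/lastP: u uI => [|u s]; first by rewrite word_prod_nil.
rewrite word_over_rcons word_prod_rcons size_rcons => -[uI Is] usz /(_ s Is).
rewrite -mulgA (simple_mulgg (IS Is)) mulg1 -usz.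
by have := cox_length_le_size (word_over_sub IS uI); lia.
Qed.

(** * Minimal coset representatives *)

Lemma coset_minimum w : exists2 x, W_I x &
  forall y, W_I y -> (l (w * x) <= l (w * x * y))%N.
Proof.
have [n] : exists n, (l w <= n)%N by exists (l w).
elim: n w => [|n IHn] w lw.
  exists 1; first exact: parabolic1.
  by move=> y _; rewrite mulg1; move: lw; rewrite leqn0 => /eqP ->.
have [[x [Wx lt_wx]]|nex] := pselect (exists x, W_I x /\ (l (w * x) < l w)%N).
  have [|y Wy ymin] := IHn (w * x); first by lia.
  by exists (x * y); [exact: parabolicM | move=> z Wz; rewrite mulgA; apply: ymin].
exists 1; first exact: parabolic1.
by move=> y Wy; rewrite mulg1 leqNgt; apply/negP => lt_wy; apply: nex; exists y.
Qed.

(** Append the letters of a reduced word for [x] one at a time. If the length dropped, exchange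
    would delete a letter either from [w], against minimality in its coset, or from the word for
    [x], against reducedness. *)
Lemma coset_minimum_cox_length w x :
  (forall y, W_I y -> (l w <= l (w * y))%N) -> W_I x -> (l (w * x) = l w + l x)%N.
Proof.
move=> wmin /parabolic_reduced_word[u [uI + xE]]; rewrite -{x}xE.
elim/last_ind: u uI => [|u s IHu].
  by rewrite word_prod_nil mulg1 cox_length1 addn0.
rewrite word_over_rcons word_prod_rcons size_rcons => -[uI Is] usz.
have uS := word_over_sub IS uI; have Ss := IS Is.
have ul : size u = l (word_prod u).
  have := cox_length_le_size uS; have := cox_lengthM (word_prod u) s.
  by rewrite -usz (cox_length_simple Ss); lia.
have {}IHu := IHu uI ul; rewrite mulgA.
have [up|down] := cox_lengthMs (w * word_prod u) Ss.
  by rewrite up IHu -usz ul addnS.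
have [c [cS csz cw]] := reduced_word_exists w.
have Wu : W_I (word_prod u) by apply/parabolicP; exists u.
have [|[c' [c'c c'sz ws]]|[u' [u'u u'sz us]]] := exchange_cat cS uS Ss.
- by rewrite cw down.
(* The shorter coset element is [w] times the conjugate of [s] by the inverse of [word_prod u]. *)
- have := wmin _ (parabolicM (parabolicM Wu (parabolic_gen Is)) (parabolicV Wu)).
  rewrite !mulgA -cw ws mulgK.
  have := cox_length_le_size (fun r rc' => cS r (c'c r rc')).
  by rewrite cw -csz; lia.
- have := cox_length_le_size (fun r ru' => uS r (u'u r ru')).
  by rewrite -us -usz; lia.
Qed.

(** Write [w] as a coset minimum [w * y] times [y^-1]. Lengths add there, so a descent of [y^-1]
    would be one of [w]; hence [y = 1] and [w] is itself the minimum. *)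
Lemma no_descent_cox_length w x :
  no_descent w -> W_I x -> (l (w * x) = l w + l x)%N.
Proof.
move=> wI; have [y Wy ymin] := coset_minimum w.
have wyM z : W_I z -> l (w * y * z) = (l (w * y) + l z)%N.
  exact: coset_minimum_cox_length.
suff y1 : y = 1 by move=> /wyM; rewrite y1 mulg1.
apply: invg_inj; rewrite invg1; apply: parabolic_no_descent => [|s Is].
  exact: parabolicV.
have := wI s Is; have := wyM _ (parabolicV Wy).
have := wyM _ (parabolicM (parabolicV Wy) (parabolic_gen Is)).
by rewrite !mulgA mulgK => -> ->; rewrite ltn_add2l.
Qed.

(** * Finiteness and existence of longest elements *)

Lemma parabolic_ball_finite n : finite_set S ->
  finite_set [set x | W_I x /\ (l x <= n)%N].
Proof.
move=> S_fin; elim: n => [|n IHn].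
  apply: (sub_finite_set _ (finite_set1 (1 : G))) => x [_].
  by rewrite leqn0 => /eqP /cox_length_eq0.
have I_fin : finite_set I := sub_finite_set IS S_fin.
have I1_fin : finite_set (I `|` [set 1]).
  by rewrite finite_setU; split=> //; apply: finite_set1.
apply: (sub_finite_set _ (finite_image2 (fun x s : G => x * s) IHn I1_fin)).
move=> x [/parabolic_reduced_word[u [+ <- <-]]].
case/lastP: u => [_ _|u s].
  exists 1; first by split; [exact: parabolic1 | rewrite cox_length1].
  by exists 1; [right | rewrite mulg1 word_prod_nil].
rewrite word_over_rcons size_rcons word_prod_rcons => -[uI Is] le_un.
exists (word_prod u); last by exists s; [left|].
split; first by apply/parabolicP; exists u.
by have := cox_length_le_size (word_over_sub IS uI); lia.
Qed.

Lemma all_descents_finite w : finite_set S -> all_descents w -> finite_set W_I.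
Proof.
move=> S_fin wI; apply: (sub_finite_set _ (parabolic_ball_finite (l w) S_fin)).
by move=> x Wx; split=> //; apply: all_descents_le.
Qed.

Lemma all_descents_longest w : all_descents w -> exists x, longest_in S I x.
Proof.
move=> wI.
have ex : exists n, `[< exists2 x, W_I x & l x = n >].
  by exists 0%N; apply/asboolP; exists 1; [exact: parabolic1 | exact: cox_length1].
have bnd n : `[< exists2 x, W_I x & l x = n >] -> (n <= l w)%N.
  by move=> /asboolP[x Wx <-]; apply: all_descents_le.
case: (ex_maxnP ex bnd) => _ /asboolP[x Wx <-] xmax.
by exists x; split=> // y Wy; apply: xmax; apply/asboolP; exists y.
Qed.

End Parabolic.
End Coxeter.

(** * The fixed group of a diagram automorphism *)

Section FixedCoxeter.
Variables (G : groupType) (S : set G) (tau : {multiplicative G -> G}).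
Hypothesis S_finite : finite_set S.
Hypothesis S_coxeter : coxeter_group S.
Hypothesis tau_bij : bijective tau.
Hypothesis tau_S : tau @` S = S.
Implicit Types (I J : set G) (s t x : G) (w y r : fixed_group tau).

Local Notation l := (cox_length S).
Local Notation R := (@fixed_reflections G S tau).

Local Open Scope group_scope.

(** * Action of the automorphism on lengths and orbits *)

Lemma tau_simple s : S (tau s) <-> S s.
Proof.
split=> [|Ss]; last by rewrite -tau_S; exists s.
by rewrite -{1}tau_S => -[t St /(bij_inj tau_bij) <-].
Qed.

Lemma tau_word_prod (u : seq G) : tau (word_prod u) = word_prod (map tau u).
Proof.
elim: u => [|s u IHu] /=; last by rewrite !word_prod_cons gmulfM IHu.
by rewrite word_prod_nil; apply: (mulgI (tau 1)); rewrite -gmulfM !mulg1.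
Qed.

Lemma tau_cox_length x : l (tau x) = l x.
Proof.
apply/eqP; rewrite eqn_leq; apply/andP; split.
  have [u [uS <- <-]] := reduced_word_exists S_coxeter x.
  rewrite tau_word_prod -(size_map tau); apply: cox_length_le_size.
  by move=> _ /mapP[s /uS Ss ->]; apply/tau_simple.
have [g tauK gK] := tau_bij.
have [u [uS <- ux]] := reduced_word_exists S_coxeter (tau x).
have <- : word_prod (map g u) = x.
  by apply: (bij_inj tau_bij); rewrite tau_word_prod mapK.
rewrite -(size_map g); apply: cox_length_le_size.
by move=> _ /mapP[s /uS Ss ->]; apply/tau_simple; rewrite gK.
Qed.

Lemma orbit_simple s : S s -> orbit_of tau s `<=` S.
Proof.
move=> Ss t [n [->|sE]]; first by elim: n => //= n IHn; apply/tau_simple.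
rewrite {}sE in Ss; elim: n Ss => //= n IHn.
by move=> /tau_simple.
Qed.

Lemma tau_orbit s t : orbit_of tau s t -> orbit_of tau s (tau t).
Proof.
case=> -[|n] [->|->]; first by exists 1%N; left.
- by exists 1%N; left.
- by exists n.+2; left.
- by exists n; right; rewrite iterSr.
Qed.

(** As [tau] fixes [w] and preserves length, [l (val w * t)] is constant for [t] in the orbit. *)
Lemma orbit_dichotomy s w : S s ->
  all_descents S (orbit_of tau s) (val w) \/ no_descent S (orbit_of tau s) (val w).
Proof.
move=> Ss.
have tau_l t : l (val w * tau t) = l (val w * t).
  by rewrite -[val w in LHS](eqP (fixed_valP w)) -gmulfM tau_cox_length.
have iter_l n t : l (val w * iter n tau t) = l (val w * t).
  by elim: n => //= n <-; apply: tau_l.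
have orbit_l t : orbit_of tau s t -> l (val w * t) = l (val w * s).
  by case=> n [->|->].
have [up|down] := cox_lengthMs S_coxeter (val w) Ss.
  by right=> t /orbit_l ->; rewrite up.
by left=> t /orbit_l ->; rewrite down.
Qed.

(** The image [tau x] is again a longest element of the same parabolic subgroup, and such an element
    is unique. *)
Lemma tau_longest s x : S s -> longest_in S (orbit_of tau s) x -> tau x = x.
Proof.
move=> Ss xmax; have IS := orbit_simple Ss.
apply: (longest_unique S_coxeter IS _ xmax); split; last first.
  by move=> y; rewrite tau_cox_length; apply: xmax.2.
have [u uI <-] := (parabolicP S_coxeter IS x).1 xmax.1.
apply/(parabolicP S_coxeter IS); exists (map tau u); last by rewrite tau_word_prod.
by move=> _ /mapP[t /uI It ->]; apply: tau_orbit.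
Qed.

(** * Generation of the fixed group by the longest elements *)

Lemma fixed_reflectionP r : R r ->
  exists I, [/\ I `<=` S, exists s, I s,
    forall w, all_descents S I (val w) \/ no_descent S I (val w)
    & longest_in S I (val r)].
Proof.
case=> I [[s Ss ->] _] rmax; exists (orbit_of tau s); split=> //.
- exact: orbit_simple.
- by exists s, 0%N; left.
- by move=> w; apply: orbit_dichotomy.
Qed.

Lemma fixed_reflection_mulgg r : R r -> r * r = 1.
Proof.
case/fixed_reflectionP => I [IS _ _ rmax]; apply: val_inj.
exact: (longest_mulgg S_coxeter IS rmax).
Qed.

(** The last letter of a reduced word is a descent, hence so is its whole orbit. This bounds lengths
    in the parabolic subgroup of the orbit, which is therefore finite, and its longest element can
    be split off [w]. *)
Lemma descent_fixed_reflection w : val w <> 1 ->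
  exists2 r, R r & (l (val (w * r)%g) < l (val w))%N.
Proof.
move=> w1; have [u [+ + uw]] := reduced_word_exists S_coxeter (val w).
case/lastP: u uw => [|u s]; first by rewrite word_prod_nil => /esym.
rewrite word_prod_rcons size_rcons word_over_rcons => uw [uS Ss] usz.
have IS := orbit_simple Ss; have Is : orbit_of tau s s by exists 0%N; left.
have wI : all_descents S (orbit_of tau s) (val w).
  case: (orbit_dichotomy w Ss) => // /(_ s Is).
  rewrite -{2}uw -mulgA (simple_mulgg S_coxeter Ss) mulg1 -usz.
  by have := cox_length_le_size uS; lia.
have [x xmax] := all_descents_longest S_coxeter IS wI.
have xP : fixed_pred tau x by apply/eqP; exact: tau_longest xmax.
exists (FixedGroup xP).
  exists (orbit_of tau s) => //; split; first by exists s.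
  exact: (all_descents_finite S_coxeter IS S_finite wI).
have := all_descents_cox_length S_coxeter IS wI (parabolicV xmax.1).
rewrite invgK cox_lengthV //; have := xmax.2 _ (parabolic_gen Is).
rewrite cox_length_simple //.
have -> : val (w * FixedGroup xP) = val w * x by rewrite gmulfM.
by lia.
Qed.

Lemma fixed_word_exists w : exists2 u, word_over R u & word_prod u = w.
Proof.
have [n] : exists n, (l (val w) <= n)%N by exists (l (val w)).
elim: n w => [|n IHn] w lw.
  exists [::]; first exact: word_over_nil.
  rewrite word_prod_nil; apply: val_inj; apply/esym.
  by apply: (cox_length_eq0 S_coxeter); move: lw; rewrite leqn0 => /eqP.
have [w1|/descent_fixed_reflection[r Rr lt_wr]] := pselect (val w = 1).
  exists [::]; first exact: word_over_nil.
  by rewrite word_prod_nil; apply: val_inj.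
have [|u uR uw] := IHn (w * r); first exact: (leq_trans lt_wr lw).
exists (rcons u r); first by rewrite word_over_rcons.
by rewrite word_prod_rcons uw -mulgA fixed_reflection_mulgg // mulg1.
Qed.

(* If [s] in [I] becomes a descent of [r * y] without being one of [y], the
   exchanged letter lies in a word for [r], so [y * s * y^-1] is in the parabolic
   subgroup [W_J] of [r]. Hence [y * w * y^-1] is a nontrivial fixed element of
   [W_J], and [r] is the only one. *)
Lemma fixed_reflection_commute I w y r : I `<=` S -> (exists s, I s) ->
  longest_in S I (val w) -> R r ->
  no_descent S I (val y) -> all_descents S I (val (r * y)) -> r * y = y * w.
Proof.
move=> IS [s0 Is0] wmax /fixed_reflectionP[J [JS _ Jdich rmax]] yI ryI.
have ryE : val (r * y) = val r * val y by rewrite gmulfM.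
have [u [uJ _ ur]] := parabolic_reduced_word S_coxeter JS rmax.1.
have [v [vS vsz vy]] := reduced_word_exists S_coxeter (val y).
have yJ s : I s -> generated_subgroup J (val y * s * (val y)^-1).
  move=> Is; have Ss := IS s Is.
  have := exchange_cat S_coxeter (word_over_sub JS uJ) vS Ss.
  rewrite ur vy -ryE => /(_ (ryI s Is))[[u' [u'u _ ryu]]|[v' [v'v vv' yv]]].
    have -> : val y * s * (val y)^-1 = (val r)^-1 * word_prod u'.
      apply: (mulgI (val r)); rewrite mulVKg.
      by apply: (mulIg (val y)); rewrite -ryu !mulgA mulgVK ryE.
    apply: (parabolicM S_coxeter JS); first exact: parabolicV rmax.1.
    by apply/(parabolicP S_coxeter JS); exists u' => // t /u'u /uJ.
  have := yI s Is; have := cox_length_le_size (fun t tv' => vS t (v'v t tv')).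
  by rewrite -yv -vsz; lia.
have yJx x :
    generated_subgroup I x -> generated_subgroup J (val y * x * (val y)^-1).
  move=> /(parabolicP S_coxeter IS)[p + <-]; elim: p => [_|s p IHp].
    by rewrite word_prod_nil mulg1 mulgV; apply: parabolic1.
  rewrite word_over_cons word_prod_cons => -[/yJ Js /IHp Jp].
  have := parabolicM S_coxeter JS Js Jp.
  by rewrite !mulgA mulgVK.
have /yJx wJ := wmax.1.
have zE : val (y * w * y^-1) = val y * val w * (val y)^-1 by rewrite !gmulfM.
rewrite -zE in wJ; apply: (mulIg y^-1); rewrite mulgK; apply: val_inj.
(* A fixed element of the parabolic subgroup of [J] has all of [J] as descents, and is the longest
   element, or none, and is trivial. Triviality would force [w = 1], although [w] has the descent
   [s0]. *)
have [zJ|zJ] := Jdich (y * w * y^-1).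
  apply: (longest_unique S_coxeter JS rmax).
  exact/(longest_all_descentsP S_coxeter JS).
have z1 := parabolic_no_descent S_coxeter JS wJ zJ.
have w1 : val w = 1.
  by apply: (mulgI (val y)); apply: (mulIg (val y)^-1); rewrite -zE z1 mulg1 mulgV.
have := longest_all_descents S_coxeter IS wmax Is0.
by rewrite w1 cox_length1.
Qed.

(** Read the word from the left. If [I] already consists of descents of the tail, delete a letter
    there; otherwise the first letter [r] creates the descents, and [r * y = y * w] lets [w] cancel
    it. *)
Lemma fixed_exchange I w u : I `<=` S -> (exists s, I s) ->
  (forall y, all_descents S I (val y) \/ no_descent S I (val y)) ->
  longest_in S I (val w) -> word_over R u -> all_descents S I (val (word_prod u)) ->
  exists v, [/\ word_over R v, size u = (size v).+1
              & word_prod u * w = word_prod v].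
Proof.
move=> IS [s0 Is0] Idich wmax.
elim: u => [_ /(_ s0 Is0)|r u IHu].
  by rewrite word_prod_nil cox_length1.
rewrite word_over_cons word_prod_cons => -[Rr uR] ruI.
have [uI|uI] := Idich (word_prod u).
  have [v [vR usz uw]] := IHu uR uI.
  exists (r :: v); split; first by rewrite word_over_cons.
    by rewrite /= usz.
  by rewrite word_prod_cons -mulgA uw.
exists u; split=> //.
rewrite (fixed_reflection_commute IS (ex_intro _ s0 Is0) wmax Rr uI ruI).
rewrite -mulgA [w * w](_ : _ = 1) ?mulg1 //; apply: val_inj.
exact: (longest_mulgg S_coxeter IS wmax).
Qed.

Lemma cox_length_fixed_word u : word_over R u ->
  size u = cox_length R (word_prod u) ->
  l (val (word_prod u)) = (\sum_(r <- u) l (val r))%N.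
Proof.
elim/last_ind: u => [_ _|u r IHu].
  by rewrite big_nil word_prod_nil cox_length1.
rewrite word_over_rcons word_prod_rcons size_rcons big_rcons => -[uR Rr] usz.
have {}IHu : l (val (word_prod u)) = (\sum_(r <- u) l (val r))%N.
  apply: IHu => //; apply/eqP; rewrite eqn_leq (cox_length_le_size uR) andbT.
  (* A prefix of a reduced word is reduced: a shorter word for the prefix would shorten the
     whole. *)
  have [v [vR <- vu]] := reduced_word uR.
  have := cox_length_le_size ((word_over_rcons R v r).2 (conj vR Rr)).
  by rewrite word_prod_rcons vu -usz size_rcons.
have [I [IS Is Idich rmax]] := fixed_reflectionP Rr.
have [uI|uI] := Idich (word_prod u).
  (* Exchange would give a word two letters shorter than the reduced word [rcons u r], so this case
     is impossible. *)
  have [v [vR vsz vE]] := fixed_exchange IS Is Idich rmax uR uI.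
  by have := cox_length_le_size vR; rewrite -vE -usz vsz => /ltnW; rewrite ltnn.
by rewrite -IHu gmulfM (no_descent_cox_length S_coxeter IS uI rmax.1).
Qed.

End FixedCoxeter.

Theorem theoremA9 (Wt : groupType) (St : set Wt)
    (tau : {multiplicative Wt -> Wt})
    (St_finite : finite_set St)
    (Wt_coxeter : coxeter_group St)
    (tau_bij : bijective tau)
    (tau_St : tau @` St = St) :
  weight_function (@fixed_reflections Wt St tau)
    (fun w : fixed_group tau => Posz (cox_length St (val w))).
Proof.
set R := @fixed_reflections Wt St tau.
have reduced w : exists u, [/\ word_over R u, size u = cox_length R (word_prod u)
                             & word_prod u = w].
  have [v vR <-] := fixed_word_exists St_finite Wt_coxeter tau_bij tau_St w.
  have [u [uR usz uv]] := reduced_word vR.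
  by exists u; rewrite uv.
have weight := cox_length_fixed_word Wt_coxeter tau_bij tau_St.
move=> w w'; have [u [uR usz <-]] := reduced w; have [v [vR vsz <-]] := reduced w'.
rewrite -word_prod_cat => uvl.
have uvR : word_over R (u ++ v) by rewrite word_over_cat.
(* Additivity of the length over [R] says that concatenating the two reduced words gives a reduced
   word. *)
have uvsz : size (u ++ v) = cox_length R (word_prod (u ++ v)).
  by rewrite uvl size_cat usz vsz.
by rewrite (weight _ uvR uvsz) (weight _ uR usz) (weight _ vR vsz) big_cat.
Qed.
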